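(* Let $A,m\in\mathbb Z$ and let $p$ be an odd prime with $p\nmid m$. Suppose that $\delta\in\mathbb Z$ satisfies $\delta^2\equiv A^2-4m^2\not\equiv0\pmod p$. Let $a,h$ be positive integers. If $\left(\frac{A+\delta}{p^a}\right)=\left(\frac{2m}{p^a}\right)$, then $$\sum_{k=0}^{p^a-1}\frac{u_k(A,m^2)\binom{2k}k^h}{m^k(-4)^{hk}}\equiv0\pmod p.$$ If $\left(\frac{A+\delta}{p^a}\right)=-\left(\frac{2m}{p^a}\right)$, then $$\sum_{k=0}^{p^a-1}\frac{v_k(A,m^2)\binom{2k}k^h}{m^k(-4)^{hk}}\equiv0\pmod p.$$
   Context: For $A,B\in\mathbb Z$ the Lucas sequences are defined by $u_0=0$, $u_1=1$, $u_{n+1}=Au_n-Bu_{n-1}$ and $v_0=2$, $v_1=A$, $v_{n+1}=Av_n-Bv_{n-1}$ ($n\ge1$); we write $u_n(A,B)$, $v_n(A,B)$. $\left(\frac{\cdot}{p^a}\right)$ denotes the Jacobi symbol. Congruences between rationals whose denominators are prime to $p$ are understood in the ring of rationals with denominators prime to $p$. *)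

(* Defs.v *)
From mathcomp Require Import all_boot all_order all_algebra.

Set Implicit Arguments.
Unset Strict Implicit.
Unset Printing Implicit Defensive.

Import GRing.Theory Num.Theory.

Local Open Scope ring_scope.

Fixpoint lucas_u (A B : int) (n : nat) : int :=
  match n with
  | 0%N => 0
  | 1%N => 1
  | (n1.+1 as n2).+1 => A * lucas_u A B n2 - B * lucas_u A B n1
  end.

Fixpoint lucas_v (A B : int) (n : nat) : int :=
  match n with
  | 0%N => 2
  | 1%N => A
  | (n1.+1 as n2).+1 => A * lucas_v A B n2 - B * lucas_v A B n1
  end.

(* Meaningful only when [q] is an odd prime. *)
Definition legendre (x : int) (q : nat) : int :=
  if (q %| x)%Z then 0
  else if [exists y : 'I_q, (y%:Z ^+ 2 == x %[mod q])%Z] then 1 else -1.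

(* Meaningful only when [n] is odd and positive. *)
Definition jacobi (x : int) (n : nat) : int :=
  \prod_(q <- primes n) legendre x q ^+ logn q n.

(* For [p] prime: [r] lies in the ring of rationals with denominator prime
   to [p]; [denq r] is the reduced, positive denominator. *)
Definition p_integral (p : nat) (r : rat) : bool := coprime p `|denq r|.

(* Congruence modulo the ideal generated by [p] in that ring; both sides are
   required to belong to the ring. *)
Definition eqmod_rat (p : nat) (x y : rat) : Prop :=
  [/\ p_integral p x, p_integral p y
    & exists2 z : rat, p_integral p z & x - y = p%:R * z].

(* Main.v *)
(** Write [p ^ a = 2 n + 1] and [F] for the field with [p] elements.  In [F],
    ['C(2k, k) / (-4)^k = 'C(-1/2, k)] equals ['C(n, k)] for [k < p ^ a], so
    [P(t) = \sum_k ('C(2k, k) / (-4)^k)^h t^k] is palindromic: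
    [P(t) = t^n P(1/t)].  With [x, y = (A + delta)/2, (A - delta)/2] the
    characteristic roots, [x y = m^2], the two sums are, up to a nonzero factor,
    [P(x/m) - P(y/m)] and [P(x/m) + P(y/m)]; moreover [y/m = (x/m)^-1], and
    [(x/m)^n] is the quotient of the two Jacobi symbols by Euler's criterion. *)
Require Import Defs.
From mathcomp Require Import all_boot all_order all_algebra.
From mathcomp Require Import cyclic finfield.
From mathcomp Require Import ring zify.

Import GRing.Theory Num.Theory.

Local Open Scope ring_scope.

(** * Self-convolutions and central binomial coefficients *)

(** For [k > 0], entry [k] of the self-convolution is [2 * c k] plus products of earlier entries, so
    dividing by 2 recovers [c] step by step: a truncated power series with constant term 1 is
    determined by its square. *)
Lemma binomial_convolution_inj (F : fieldType) (q : nat) (c d : nat -> F) :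
    2%:R != 0 :> F -> c 0%N = 1 -> d 0%N = 1 ->
    (forall k, (k < q)%N ->
       \sum_(i < k.+1) c i * c (k - i)%N = \sum_(i < k.+1) d i * d (k - i)%N) ->
  forall k, (k < q)%N -> c k = d k.
Proof.
move=> two_neq0 c0 d0 cd; elim/ltn_ind=> -[|k] IHk ltkq; first by rewrite c0 d0.
have := cd _ ltkq.
rewrite 2![\sum_(_ < k.+2) _]big_ord_recl !big_ord_recr /=.
rewrite !subn0 /bump /= !add1n subnn c0 d0.
rewrite !mul1r !mulr1.
set s := \sum_(i < k) c _ * _; set s' := \sum_(i < k) d _ * _.
have <- : s = s'.
  apply: eq_bigr => i _; have lti := ltn_ord i.
  by rewrite /bump /= !add1n !IHk //; lia.
move=> e.
have /eqP : 2%:R * (c k.+1 - d k.+1) = 0.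
  rewrite mulrBr; apply/eqP; rewrite subr_eq0; apply/eqP.
  by move: e; rewrite !(addrC s) !addrA => /addIr; rewrite -!mulr2n !mulr_natl => ->.
by rewrite mulf_eq0 (negPf two_neq0) /= subr_eq0 => /eqP.
Qed.

Lemma central_binS (k : nat) :
  (k.+1 * 'C(2 * k.+1, k.+1) = (4 * k + 2) * 'C(2 * k, k))%N.
Proof.
have e1 := mul_bin_diag (2 * k).+2 k.
have e2 := mul_bin_down (2 * k).+1 k.
have -> : (2 * k.+1 = (2 * k).+2)%N by lia.
rewrite /= in e1 e2; rewrite -e1.
have -> : ((2 * k).+2 = 2 * k.+1)%N by lia.
have e3 : ((2 * k).+1 - k = k.+1)%N by lia.
by rewrite -mulnA -e3 -e2 mulnA; congr (_ * _)%N; lia.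
Qed.

(** Coefficientwise square of [(1 - 4X)^(-1/2)]. Swapping [i] with [k - i] shows that weighting the
    terms by [i] multiplies the sum [S k] by [k / 2]; with [central_binS] this gives
    [(k + 1) S (k + 1) = 4 (k + 1) S k]. *)
Lemma central_bin_convolution (k : nat) :
  (\sum_(i < k.+1) 'C(2 * i, i) * 'C(2 * (k - i), k - i) = 4 ^ k)%N.
Proof.
pose c i := 'C(2 * i, i); pose S l := (\sum_(i < l.+1) c i * c (l - i))%N.
have weighted l : ((\sum_(i < l.+1) i * (c i * c (l - i))) * 2 = l * S l)%N.
  rewrite muln2 -addnn {2}(reindex_inj rev_ord_inj) -big_split big_distrr /=.
  apply: eq_bigr => i _; have lei : (i <= l)%N by rewrite -ltnS.
  by rewrite subSS subKn // [(c (l - i) * _)%N]mulnC -mulnDl subnKC.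
elim: k => [|k IHk]; first by rewrite big_ord1.
rewrite -/(S k) in IHk; rewrite -/(S k.+1) expnS -IHk.
have /eqP := weighted k.+1.
rewrite big_ord_recl mul0n add0n.
under eq_bigr => i _.
  rewrite /= /bump /= add1n subSS mulnA central_binS -/(c i) -mulnA mulnDl.
  rewrite -mulnA; over.
rewrite big_split /= -!big_distrr /= -/(S k).
rewrite mulnDl => /eqP e; apply/eqP.
rewrite -(eqn_pmul2l (ltn0Sn k)) -e; apply/eqP.
rewrite -mulnA weighted; move: (S k) => s; ring.
Qed.

(** * Binomial coefficients in characteristic [p], and a palindromic sum *)

Section PrimeChar.

Context (F : fieldType) (p : nat) (charFp : p \in [pchar F]).

(** Since [k * 'C(p ^ a, k) = p ^ a * 'C(p ^ a - 1, k - 1)], a binomial prime to [p] would force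
    [p ^ a] to divide the smaller positive number [k]. *)
Lemma bin_pfactor_eq0 (a k : nat) :
  (0 < k < p ^ a)%N -> 'C(p ^ a, k)%:R = 0 :> F.
Proof.
move=> /andP[k_gt0 ltk]; have p_prime := pcharf_prime charFp.
apply/eqP; rewrite -(dvdn_pcharf charFp); case: k k_gt0 ltk => // k _ ltk.
apply/negPn/negP => ndvd.
have : (p ^ a %| k.+1 * 'C(p ^ a, k.+1))%N by rewrite -mul_bin_diag dvdn_mulr.
rewrite Gauss_dvdl; first by move=> /dvdn_leq -/(_ isT); lia.
by rewrite coprimeXl // prime_coprime.
Qed.

Lemma bin_pred_pfactor (a k : nat) :
  (k < p ^ a)%N -> 'C((p ^ a).-1, k)%:R = (-1) ^+ k :> F.
Proof.
elim: k => [|k IHk] ltk; first by rewrite bin0.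
have /eqP := bin_pfactor_eq0 a k.+1 ltk.
rewrite -(ltn_predK ltk) binS natrD IHk; last exact: ltnW.
by rewrite addr_eq0 => /eqP->; rewrite exprS mulN1r.
Qed.

(** Both sides start at 1 and have self-convolution [4 ^ k] for [k < p ^ a]: on the right,
    Vandermonde yields [(-4) ^ k * 'C(p ^ a - 1, k)], and that binomial is [(-1) ^ k] in [F]. *)
Lemma central_bin_half (a k : nat) : odd p -> (k < p ^ a)%N ->
  'C(2 * k, k)%:R = (-4) ^+ k * 'C((p ^ a)./2, k)%:R :> F.
Proof.
move=> p_odd; pose d k := (-4) ^+ k * 'C((p ^ a)./2, k)%:R : F.
move: k; apply: (binomial_convolution_inj F _ (fun k => 'C(2 * k, k)%:R) d) => //.
- rewrite -(dvdn_pcharf charFp) dvdn_prime2 ?(pcharf_prime charFp) //.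
  by apply/eqP => p2; rewrite p2 in p_odd.
- by rewrite /d bin0 mulr1.
move=> k ltk.
under eq_bigr => i _ do rewrite -natrM.
rewrite -natr_sum central_bin_convolution.
have -> : \sum_(i < k.+1) d i * d (k - i)%N
    = (-4) ^+ k * (\sum_(i < k.+1) 'C((p ^ a)./2, i) * 'C((p ^ a)./2, k - i))%:R.
  rewrite natr_sum mulr_sumr; apply: eq_bigr => i _.
  rewrite /d mulrACA -exprD subnKC ?natrM // -ltnS; exact: ltn_ord.
rewrite binomial.Vandermonde addnn.
have -> : ((p ^ a)./2.*2 = (p ^ a).-1)%N.
  by rewrite -[in RHS](odd_double_half (p ^ a)) oddX p_odd orbT.
by rewrite bin_pred_pfactor // -exprMn mulrN1 opprK natrX.
Qed.

End PrimeChar.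

(** Once the sum is cut at [n], replacing [k] by [n - k] preserves the binomials and turns [t ^ k]
    into [t ^ n * t^-1 ^ k]. *)
Lemma sum_bin_palindrome (F : fieldType) (n h q : nat) (t : F) :
    (0 < h)%N -> (n < q)%N -> t != 0 ->
  \sum_(0 <= k < q) 'C(n, k)%:R ^+ h * t ^+ k
  = t ^+ n * \sum_(0 <= k < q) 'C(n, k)%:R ^+ h * t^-1 ^+ k.
Proof.
move=> h_gt0 ltnq t_neq0.
have trunc (s : F) : \sum_(0 <= k < q) 'C(n, k)%:R ^+ h * s ^+ k
    = \sum_(k < n.+1) 'C(n, k)%:R ^+ h * s ^+ k.
  rewrite (big_cat_nat _ (n := n.+1)) //= big_mkord [X in _ + X]big_nat_cond.
  rewrite [X in _ + X]big1 ?addr0 // => k /andP[/andP[ltnk _] _].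
  (* Here [h > 0] matters: a vanishing binomial to the power 0 would count as 1. *)
  by rewrite bin_small // expr0n gtn_eqF // mul0r.
rewrite !trunc (reindex_inj rev_ord_inj) mulr_sumr /=; apply: eq_bigr => k _.
have lekn : (k <= n)%N by rewrite -ltnS.
by rewrite subSS bin_sub // mulrCA exprVn -expfB_cond ?(negPf t_neq0).
Qed.

(** * Quadratic residue symbols as powers in a finite field *)

(** A square [y ^+ 2] has [n]-th power [y ^+ n.*2 = 1]. In general [x ^+ n] is 1 or -1; if it is 1,
    writing [x = z ^+ i] for a generator [z] of the nonzero elements makes [i] even, so [x] is a
    square. *)
Lemma euler_criterion (F : finFieldType) (n : nat) (x : F) :
    #|F| = n.*2.+1 -> x != 0 ->
  x ^+ n = if [exists y : F, y ^+ 2 == x] then 1 else -1.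
Proof.
move=> cardF x_neq0.
have expn2 (y : F) : y != 0 -> y ^+ n.*2 = 1.
  move=> y_neq0; apply: (mulfI y_neq0).
  by rewrite -exprS -cardF expf_card mulr1.
have n_gt0 : (0 < n)%N.
  by have := finNzRing_gt1 F; rewrite cardF; lia.
case: existsP => [[y /eqP yx]|nsq].
  rewrite -yx -exprM mul2n expn2 //.
  by apply: contra_neq x_neq0 => y0; rewrite -yx y0 expr0n.
have : (x ^+ n) ^+ 2 == 1 by rewrite -exprM muln2 expn2.
rewrite sqrf_eq1 => /orP[/eqP xn1|/eqP //]; case: nsq.
have /hasP[z _ prim_z] : has (n.*2).-primitive_root (enum (predC1 (0 : F))).
  apply: has_prim_root; rewrite ?double_gt0 ?enum_uniq //.
    by apply/allP=> y; rewrite mem_enum inE => /expn2/eqP; rewrite unity_rootE.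
  by rewrite -cardE cardC1 cardF.
have [[i /= _] xi] := prim_rootP prim_z (expn2 _ x_neq0).
move: xn1; rewrite xi -exprM => /eqP; rewrite -(prim_order_dvd prim_z).
rewrite -mul2n dvdn_pmul2r // => /dvdnP[j ->].
by exists (z ^+ j); rewrite -exprM.
Qed.

Lemma legendre_Fp (p : nat) (x : int) : prime p -> odd p -> ~~ (p %| x)%Z ->
  (legendre x p)%:~R = x%:~R ^+ p./2 :> 'F_p.
Proof.
move=> p_prime p_odd ndvd; have charFp := pchar_Fp p_prime.
rewrite /legendre (negPf ndvd) (euler_criterion _ p./2); first last.
- by rewrite -(dvdz_pcharf charFp).
- by rewrite card_Fp // -[LHS](odd_double_half p) p_odd.
have -> : [exists y : 'I_p, (y%:Z ^+ 2 == x %[mod p])%Z]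
    = [exists y : 'F_p, y ^+ 2 == x%:~R].
  apply/existsP/existsP => -[y]; rewrite ?eqz_mod_dvd.
    rewrite (dvdz_pcharf charFp) rmorphB rmorphXn subr_eq0 => yx.
    by exists (y%:R).
  (* The ordinal type behind ['F_p] has bound [p] only through [Fp_cast], so the representative is
     repackaged in ['I_p]. *)
  move=> yx; have lty : (y < p)%N by rewrite -[X in (_ < X)%N](Fp_cast p_prime).
  exists (Ordinal lty); rewrite eqz_mod_dvd (dvdz_pcharf charFp).
  by rewrite rmorphB rmorphXn subr_eq0 /= -pmulrn natr_Zp.
by case: ifP => _; rewrite ?rmorphN.
Qed.

(** The symbol is the [a]-th power of the Legendre symbol. The exponents match by induction on [a]:
    [(p ^ a.+1)./2 = (p ^ a)./2 * p + p./2], and raising to the power [p] is the identity on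
    ['F_p]. *)
Lemma jacobi_pfactor_Fp (p a : nat) (x : int) :
    prime p -> odd p -> (0 < a)%N -> ~~ (p %| x)%Z ->
  (jacobi x (p ^ a))%:~R = x%:~R ^+ (p ^ a)./2 :> 'F_p.
Proof.
move=> p_prime p_odd a_gt0 ndvd.
rewrite /jacobi primesX // primes_prime // big_seq1 pfactorK // rmorphXn /=.
rewrite legendre_Fp //; elim: {a_gt0} a => [|a IHa] //.
have -> : ((p ^ a.+1)./2 = (p ^ a)./2 * p + p./2)%N.
  have := odd_double_half (p ^ a); have := odd_double_half p.
  rewrite oddX p_odd orbT expnS => ep ea.
  suff -> : (p * p ^ a = ((p ^ a)./2 * p + p./2).*2.+1)%N
    by rewrite /= uphalf_double.
  rewrite -{1}ea mulnDr muln1 -doubleMr (mulnC p); lia.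
have frobenius (z : 'F_p) : z ^+ p = z by have := expf_card z; rewrite card_Fp.
by rewrite exprSr IHa exprD exprM frobenius.
Qed.

(** * Binet formulas *)

Section LucasBinet.

Context (F : comPzRingType) (A B : int) (x y : F).
Context (xDy : x + y = A%:~R) (xMy : x * y = B%:~R).

(** Kept free of division so that it makes sense in any commutative ring; the recurrence has order
    two, so the induction carries two consecutive indices. *)
Lemma lucas_u_binet (k : nat) :
  (lucas_u A B k)%:~R * (x - y) = x ^+ k - y ^+ k.
Proof.
suff: (lucas_u A B k)%:~R * (x - y) = x ^+ k - y ^+ k
    /\ (lucas_u A B k.+1)%:~R * (x - y) = x ^+ k.+1 - y ^+ k.+1 by case.
elim: k => [|k [IH1 IH2]]; first by rewrite /= mul0r mul1r subrr.
split=> //; rewrite [lucas_u _ _ _]/= -/(lucas_u A B k.+1) rmorphB !rmorphM /=.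
rewrite mulrBl -!mulrA IH1 IH2 -xDy -xMy !exprS; ring.
Qed.

Lemma lucas_v_binet (k : nat) : (lucas_v A B k)%:~R = x ^+ k + y ^+ k.
Proof.
suff: (lucas_v A B k)%:~R = x ^+ k + y ^+ k
    /\ (lucas_v A B k.+1)%:~R = x ^+ k.+1 + y ^+ k.+1 by case.
elim: k => [|k [IH1 IH2]]; first by rewrite /= -xDy.
split=> //; rewrite [lucas_v _ _ _]/= -/(lucas_v A B k.+1) rmorphB !rmorphM /=.
rewrite IH1 IH2 -xDy -xMy !exprS; ring.
Qed.

End LucasBinet.

(** * From identities in the prime field to congruences between rationals *)

(** The reduced denominator divides [d]. *)
Lemma p_integral_frac (p : nat) (n d : int) :
  prime p -> ~~ (p %| d)%Z -> p_integral p (n%:~R / d%:~R).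
Proof.
move=> p_prime; case: divqP => [|g r _]; first by rewrite dvdz0.
rewrite /p_integral prime_coprime //; apply: contra.
by rewrite dvdzE abszM => /dvdn_mull->.
Qed.

Lemma eqmod_rat_sum_frac (p q : nat) (n d : nat -> int) : prime p ->
    (forall k, ~~ (p %| d k)%Z) ->
    \sum_(0 <= k < q) (n k)%:~R / (d k)%:~R = 0 :> 'F_p ->
  eqmod_rat p (\sum_(0 <= k < q) (n k)%:~R / (d k)%:~R) 0.
Proof.
move=> p_prime d_unit; have charFp := pchar_Fp p_prime.
(* One common fraction [N / D] must represent the sum both in [rat] and in ['F_p]; both evaluations
   are therefore built in the same induction. *)
have [N [D [D_unit -> ->]]] : exists N D : int, [/\ ~~ (p %| D)%Z,
    \sum_(0 <= k < q) (n k)%:~R / (d k)%:~R = N%:~R / D%:~R :> rat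
  & \sum_(0 <= k < q) (n k)%:~R / (d k)%:~R = N%:~R / D%:~R :> 'F_p].
  elim: q => [|q [N [D [D_unit eQ eF]]]].
    exists 0, 1; split; rewrite ?big_nil ?mul0r //.
    by rewrite dvdzE /= dvdn1; case: eqP p_prime => // ->.
  have nz z : ~~ (p %| z)%Z -> z%:~R != 0 :> rat.
    by apply: contra; rewrite intr_eq0 => /eqP->; rewrite dvdz0.
  exists (N * d q + n q * D), (D * d q).
  have nzF z : ~~ (p %| z)%Z -> z%:~R != 0 :> 'F_p.
    by rewrite (dvdz_pcharf charFp).
  split; first by rewrite (dvdz_pcharf charFp) rmorphM mulf_neq0 // nzF.
    by rewrite big_nat_recr //= eQ !rmorphD !rmorphM -addf_div ?nz.
  by rewrite big_nat_recr //= eF !rmorphD !rmorphM -addf_div ?nzF.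
have D_neq0 : D%:~R != 0 :> 'F_p by rewrite -(dvdz_pcharf charFp).
move/eqP; rewrite mulf_eq0 invr_eq0 (negPf D_neq0) orbF -(dvdz_pcharf charFp).
move=> /dvdzP[N' ->]; split; first exact: p_integral_frac.
  by rewrite /p_integral coprimen1.
(* Vanishing in ['F_p] gave [N = N' * p], so this is the sum divided by [p]. *)
exists (N'%:~R / D%:~R); first exact: p_integral_frac.
by rewrite subr0 rmorphM mulrAC mulrC.
Qed.

Theorem theorem1p1 (A m : int) (p : nat) (p_prime : prime p) (p_odd : odd p)
    (p_ndvd_m : ~~ (p %| m)%Z) (delta : int)
    (delta_sq : (delta ^+ 2 = A ^+ 2 - 4 * m ^+ 2 %[mod p])%Z)
    (disc_neq0 : (A ^+ 2 - 4 * m ^+ 2 <> 0 %[mod p])%Z)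
    (a h : nat) (a_gt0 : (0 < a)%N) (h_gt0 : (0 < h)%N) :
  (jacobi (A + delta) (p ^ a) = jacobi (2 * m) (p ^ a) ->
   eqmod_rat p
     (\sum_(0 <= k < p ^ a)
        (lucas_u A (m ^+ 2) k)%:~R * 'C(2 * k, k)%:R ^+ h
        / (m%:~R ^+ k * (-4) ^+ (h * k)))
     0)
  /\
  (jacobi (A + delta) (p ^ a) = - jacobi (2 * m) (p ^ a) ->
   eqmod_rat p
     (\sum_(0 <= k < p ^ a)
        (lucas_v A (m ^+ 2) k)%:~R * 'C(2 * k, k)%:R ^+ h
        / (m%:~R ^+ k * (-4) ^+ (h * k)))
     0).
Proof.
have charFp := pchar_Fp p_prime.
set q := (p ^ a)%N; pose n := q./2.
have ndvd2 : ~~ (p %| 2)%Z.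
  rewrite dvdzE dvdn_prime2 //.
  by apply: contraL p_odd => /eqP /= ->.
have p_Fp z : ~~ (p %| z)%Z = (z%:~R != 0 :> 'F_p) by rewrite (dvdz_pcharf charFp).
have two_neq0 : 2%:R != 0 :> 'F_p by rewrite -[2%:R]/(2%:~R) -p_Fp.
have four_neq0 : 4%:R != 0 :> 'F_p by rewrite (natrM _ 2 2) mulf_neq0.
have m_neq0 : m%:~R != 0 :> 'F_p by rewrite -p_Fp.
have ltnq : (n < q)%N.
  have q_gt0 : (0 < q)%N by rewrite expn_gt0 prime_gt0.
  by rewrite /n ltn_half_double -addnn -[X in (X < _)%N]addn0 ltn_add2l.
pose x : 'F_p := (A%:~R + delta%:~R) / 2%:R.
pose y : 'F_p := (A%:~R - delta%:~R) / 2%:R.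
have xDy : x + y = A%:~R by rewrite /x /y; field.
have xBy : x - y = delta%:~R by rewrite /x /y; field.
have disc : delta%:~R ^+ 2 = A%:~R ^+ 2 - 4%:R * m%:~R ^+ 2 :> 'F_p.
  move/eqP: delta_sq; rewrite eqz_mod_dvd (dvdz_pcharf charFp).
  by rewrite !rmorphB !rmorphXn rmorphM rmorphXn subr_eq0 => /eqP.
have xMy : x * y = (m ^+ 2)%:~R.
  have -> : x * y = (A%:~R ^+ 2 - delta%:~R ^+ 2) / 4%:R.
    by rewrite /x /y; field; rewrite ?two_neq0 ?four_neq0.
  by rewrite rmorphXn disc; field.
(* The nonzero discriminant makes the roots distinct, which later allows cancelling [x - y] in the
   formula for [u]. *)
have xBy_neq0 : x - y != 0.
  rewrite xBy; apply/eqP => d0; apply: disc_neq0; apply/eqP.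
  rewrite eqz_mod_dvd subr0 (dvdz_pcharf charFp).
  by rewrite rmorphB rmorphXn rmorphM rmorphXn /= -disc d0 expr0n.
have x_neq0 : x != 0.
  apply: contra_neq m_neq0 => x0; apply/eqP.
  by rewrite -sqrf_eq0 -rmorphXn /= -xMy x0 mul0r.
pose t := x / m%:~R.
have t_neq0 : t != 0 by rewrite mulf_neq0 ?invr_eq0.
have tV : t^-1 = y / m%:~R.
  apply: (mulfI t_neq0); rewrite divff // mulf_div xMy rmorphXn -expr2 /= divff //.
  by rewrite expf_neq0.
pose P s : 'F_p := \sum_(0 <= k < q) 'C(n, k)%:R ^+ h * s ^+ k.
have P_sym : P t = t ^+ n * P t^-1 by exact: sum_bin_palindrome.
have jacE z : ~~ (p %| z)%Z -> (jacobi z q)%:~R = z%:~R ^+ n :> 'F_p.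
  exact: jacobi_pfactor_Fp.
(* The 2 here matches the one in [2 * m]: in the quotient of the two symbols the powers of 2 cancel
   and [(x / m) ^ n] remains. *)
have Adelta : (A + delta)%:~R = 2%:R * x.
  by rewrite rmorphD /x mulrCA divff // mulr1.
have J_Adelta : (jacobi (A + delta) q)%:~R = (2%:R * x) ^+ n.
  by rewrite -Adelta jacE // p_Fp Adelta mulf_neq0.
have J_2m : (jacobi (2 * m) q)%:~R = (2%:R * m%:~R) ^+ n :> 'F_p.
  by rewrite jacE ?p_Fp rmorphM ?mulf_neq0.
have tn : t ^+ n = (jacobi (A + delta) q)%:~R / (jacobi (2 * m) q)%:~R.
  by rewrite J_Adelta J_2m -expr_div_n -mulf_div divff // mul1r.
have J_2m_neq0 : (jacobi (2 * m) q)%:~R != 0 :> 'F_p.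
  by rewrite J_2m expf_neq0 // mulf_neq0.
(* Shared by [u] and [v]: modulo [p], the factor [(-4) ^ (h * k)] cancels against the [h]-th power
   of [central_bin_half]. *)
have reduction (w : nat -> int) :
    \sum_(0 <= k < q) 'C(n, k)%:R ^+ h * ((w k)%:~R / m%:~R ^+ k) = 0 :> 'F_p ->
    eqmod_rat p (\sum_(0 <= k < q)
      (w k)%:~R * 'C(2 * k, k)%:R ^+ h / (m%:~R ^+ k * (-4) ^+ (h * k))) 0.
  move=> sum0; pose N k : int := w k * 'C(2 * k, k)%:R ^+ h.
  pose D k : int := m ^+ k * (-4) ^+ (h * k).
  under eq_bigr => k _.
    have -> : (w k)%:~R * 'C(2 * k, k)%:R ^+ h / (m%:~R ^+ k * (-4) ^+ (h * k))
        = (N k)%:~R / (D k)%:~R :> rat.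
      by rewrite /N /D !rmorphM !rmorphXn /= rmorph_nat.
    over.
  apply: eqmod_rat_sum_frac => // [k|].
    by rewrite p_Fp /D rmorphM !rmorphXn mulf_neq0 ?expf_neq0 // rmorphN oppr_eq0.
  rewrite -[RHS]sum0; apply: eq_big_nat => k /andP[_ ltk].
  rewrite /N /D !rmorphM !rmorphXn /= rmorph_nat (central_bin_half _ p charFp a) //.
  rewrite exprMn -exprM [(h * k)%N]mulnC -/n.
  have : (-4 : 'F_p) ^+ (k * h) != 0 by rewrite expf_neq0 // oppr_eq0.
  have : (m%:~R : 'F_p) ^+ k != 0 by rewrite expf_neq0.
  move: (_ ^+ k) (_ ^+ (k * h)) => M e M_neq0 e_neq0.
  by rewrite mulrCA [M * e]mulrC -mulf_div divff // mul1r mulrAC mulrC.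
split=> eqJ; apply: reduction.
(* Multiplying by [x - y] turns [u] into a difference of powers; equal symbols mean [t ^ n = 1], so
   [P t = P t^-1]. *)
- apply: (mulfI xBy_neq0); rewrite mulr0 mulr_sumr.
  transitivity (P t - P t^-1); last by rewrite P_sym tn eqJ divff // mul1r subrr.
  rewrite /P -sumrB; apply: eq_bigr => k _.
  rewrite mulrCA [(x - y) * _]mulrA [(x - y) * _]mulrC.
  rewrite (lucas_u_binet _ _ _ _ _ xDy xMy).
  by rewrite tV /t !expr_div_n mulrBl mulrBr.
(* Opposite symbols mean [t ^ n = -1], so [P t = - P t^-1]. *)
- transitivity (P t + P t^-1); last first.
    by rewrite P_sym tn eqJ rmorphN mulNr divff // mulN1r addNr.
  rewrite /P -big_split; apply: eq_bigr => k _ /=.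
  rewrite (lucas_v_binet _ _ _ _ _ xDy xMy).
  by rewrite tV /t !expr_div_n mulrDl mulrDr.
Qed.
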